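(* Let $G$ be a connected graph on $n$ vertices and $m\geq 1$ edges. Then $$S(\mathcal{T}(G))\geq\sqrt{\left(\frac{2m^2+n\left(Z_g(G)-2m\right)}{mn}\right)^2-\frac{8\left(Z_g(G)-4m\right)}{n}}.$$
   Context: Graphs are finite, simple and undirected. $Z_g(G)=\sum_{i\in V(G)}d(i)^2$ is the (first) Zagreb index, $d(i)$ being the degree of vertex $i$. The line graph $\mathcal{L}(G)$ has the edges of $G$ as vertices, two being adjacent if the corresponding edges share a vertex. The total graph $\mathcal{T}(G)$ has vertex set $V(G)\cup E(G)$; two vertices of $\mathcal{T}(G)$ are adjacent if the corresponding elements are two adjacent vertices of $G$, or two edges of $G$ adjacent in $\mathcal{L}(G)$, or a vertex and an edge of $G$ incident with each other. For a graph $H$, $S(H)$ is its spread: the largest minus the smallest eigenvalue of its adjacency matrix. *)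

(* Defs.v *)
From HB Require Import structures.
From mathcomp Require Import all_boot all_order all_algebra.
From mathcomp Require Import boolp classical_sets reals polyrcf.

Set Implicit Arguments.
Unset Strict Implicit.
Unset Printing Implicit Defensive.

Import Order.TTheory GRing.Theory Num.Theory.
Local Open Scope ring_scope.

Record sgraph := SGraph {
  vertex :> finType;
  adj : rel vertex;
  adj_sym : symmetric adj;
  adj_irr : irreflexive adj
}.

Definition connected_graph (G : sgraph) : Prop :=
  forall x y : G, connect (@adj G) x y.

Definition degree (G : sgraph) (x : G) : nat := #|[set y : G | adj x y]|.

Definition zagreb (G : sgraph) : nat := (\sum_(x : G) degree x ^ 2)%N.

Definition edges (G : sgraph) : {set {set G}} :=
  [set [set p.1; p.2] | p : G * G & adj p.1 p.2].

Definition edge (G : sgraph) : finType := {a : {set G} | a \in edges G}.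

Definition line_adj (G : sgraph) : rel (edge G) :=
  fun a b => (a != b) && [exists x, (x \in val a) && (x \in val b)].

Fact line_adj_sym (G : sgraph) : symmetric (@line_adj G).
Proof.
move=> a b; rewrite /line_adj eq_sym; congr (_ && _).
by apply: eq_existsb => x; rewrite andbC.
Qed.

Fact line_adj_irr (G : sgraph) : irreflexive (@line_adj G).
Proof. by move=> a; rewrite /line_adj eqxx. Qed.

Definition line_graph (G : sgraph) : sgraph :=
  SGraph (@line_adj_sym G) (@line_adj_irr G).

Definition total_adj (G : sgraph) : rel (G + edge G)%type :=
  fun u v =>
    match u, v with
    | inl x, inl y => adj x y
    | inr a, inr b => @adj (line_graph G) a b
    | inl x, inr a => x \in val a
    | inr a, inl x => x \in val a
    end.

Fact total_adj_sym (G : sgraph) : symmetric (@total_adj G).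
Proof. by move=> [x|a] [y|b] //=; [exact: adj_sym | exact: line_adj_sym]. Qed.

Fact total_adj_irr (G : sgraph) : irreflexive (@total_adj G).
Proof. by move=> [x|a] /=; [exact: adj_irr | exact: line_adj_irr]. Qed.

Definition total_graph (G : sgraph) : sgraph :=
  SGraph (@total_adj_sym G) (@total_adj_irr G).

Definition adjacency_mx (R : realType) (G : sgraph) : 'M[R]_#|G| :=
  \matrix_(i, j) (adj (enum_val i) (enum_val j))%:R.

Definition largest_eigenvalue (R : realType) (k : nat) (A : 'M[R]_k) : R :=
  sup [set a : R | eigenvalue A a]%classic.

Definition smallest_eigenvalue (R : realType) (k : nat) (A : 'M[R]_k) : R :=
  inf [set a : R | eigenvalue A a]%classic.

Fact finite_spectrum (R : realType) (k : nat) (A : 'M[R]_k) :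
  exists s : seq R, forall a, eigenvalue A a = (a \in s).
Proof.
have p0 : char_poly A != 0 by rewrite monic_neq0 // char_poly_monic.
exists (rootsR (char_poly A)) => a.
by rewrite eigenvalue_root_char -(roots_on_rootsR p0) inE.
Qed.

Fact seq_max (R : realType) (s : seq R) (a : R) : a \in s ->
  exists2 c, c \in s & {in s, forall b, b <= c}.
Proof.
elim: s a => // x [|y s] IHs a _.
  by exists x; rewrite ?mem_head // => b; rewrite inE => /eqP->.
have [c cs cmax] := IHs y (mem_head _ _).
have [xc|cx] := leP x c.
  exists c; first by rewrite inE cs orbT.
  by move=> b; rewrite inE => /orP[/eqP->|/cmax].
exists x; rewrite ?mem_head // => b; rewrite inE => /orP[/eqP->//|/cmax bc].
exact: le_trans bc (ltW cx).
Qed.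

(* The spectrum is finite, so the supremum and infimum above are attained as
   soon as the matrix has a real eigenvalue. *)
Fact largest_eigenvalueP (R : realType) (k : nat) (A : 'M[R]_k) (a : R) :
  eigenvalue A a ->
  eigenvalue A (largest_eigenvalue A) /\
  forall b, eigenvalue A b -> b <= largest_eigenvalue A.
Proof.
have [s sE] := finite_spectrum A; rewrite sE => /seq_max[c cs cmax].
suff -> : largest_eigenvalue A = c.
  by rewrite sE; split=> // b; rewrite sE; apply: cmax.
have ubc : ubound [set a : R | eigenvalue A a]%classic c.
  by move=> b /=; rewrite sE; apply: cmax.
have Ec : [set a : R | eigenvalue A a]%classic c by rewrite /= sE.
apply/le_anti/andP; split; first by apply: ge_sup => //; exists c.
by apply: ub_le_sup => //; exists c.
Qed.

Fact smallest_eigenvalueP (R : realType) (k : nat) (A : 'M[R]_k) (a : R) :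
  eigenvalue A a ->
  eigenvalue A (smallest_eigenvalue A) /\
  forall b, eigenvalue A b -> smallest_eigenvalue A <= b.
Proof.
have [s sE] := finite_spectrum A; rewrite sE => ain.
have /seq_max[c /mapP[d ds ->] cmax] := map_f -%R ain.
have dmin b : b \in s -> d <= b by move=> bs; rewrite -lerN2 cmax // map_f.
suff -> : smallest_eigenvalue A = d.
  by rewrite sE; split=> // b; rewrite sE; apply: dmin.
have lbd : lbound [set a : R | eigenvalue A a]%classic d.
  by move=> b /=; rewrite sE; apply: dmin.
have Ed : [set a : R | eigenvalue A a]%classic d by rewrite /= sE.
apply/le_anti/andP; split; first by apply: ge_inf => //; exists d.
by apply: lb_le_inf => //; exists d.
Qed.

Definition spread (R : realType) (G : sgraph) : R :=
  largest_eigenvalue (adjacency_mx R G) -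
  smallest_eigenvalue (adjacency_mx R G).

(* Main.v *)
Require Import Defs.
From mathcomp Require Import all_boot all_order all_algebra.
From mathcomp Require Import reals.
From mathcomp Require Import spectral sesquilinear complex ring lra.
Import Order.TTheory GRing.Theory Num.Theory.
Local Open Scope ring_scope.

(** The vertex set of the total graph T(G) splits into two cells, the vertices
    of G and the edges of G. Evaluate the quadratic form of the adjacency
    matrix A of T(G) on the vectors equal to s on the first cell and to t on
    the second: it is a binary form q(s,t) whose coefficients are the numbers
    of adjacent ordered pairs inside and between the cells. Double counting
    gives 2m pairs of vertices, 2m vertex-edge incidences, and Z_g(G) - 2m
    ordered pairs of adjacent edges, so
      q(s,t) = 2m s^2 + 4m s t + (Z_g(G) - 2m) t^2,
    while the squared norm of the vector is n s^2 + m t^2.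

    By the Rayleigh principle, q lies between l and L times the squared norm,
    where l and L are the extreme eigenvalues of A. Hence L - l is at least the
    gap between the two eigenvalues of q relative to n s^2 + m t^2, which are
    those of the quotient matrix of average row sums; that gap is
    sqrt(trace^2 - 4 det), the right-hand side of the bound. The
    Rayleigh principle is [rayleigh_le_largest] and [smallest_le_rayleigh], the
    2 x 2 argument is [binary_form_gap], and the counting is done in
    [sum_adj], [sum_incidence] and [sum_line_adj], collected in
    [blockwise_form]. *)

(** * The Rayleigh principle for real symmetric matrices *)

(** The weights are the squared moduli of the coordinates of [x] in an
    orthonormal eigenbasis, so both sums are the quadratic form and the norm
    read in that basis. The basis comes from the unitary diagonalization of [A]
    over the complex numbers; only the eigenvalues and the moduli are brought
    back to [R], which avoids the need for a real eigenbasis. *)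
Lemma symmetric_spectral_weights (R : rcfType) (k : nat) (A : 'M[R]_k)
    (x : 'rV[R]_k) : A^T = A ->
  exists d w : 'I_k -> R,
    [/\ forall i, eigenvalue A (d i), forall i, 0 <= w i,
        (x *m A *m x^T) 0 0 = \sum_i d i * w i &
        (x *m x^T) 0 0 = \sum_i w i].
Proof.
move=> Asym; pose toC := real_complex R.
pose AC : 'M[R[i]]_k := map_mx toC A; pose xC : 'rV[R[i]]_k := map_mx toC x.
have conj_toC p q (B : 'M[R]_(p, q)) :
    map_mx Num.conj (map_mx toC B) = map_mx toC B.
  by apply/matrixP => i j; rewrite !mxE; apply: conjc_real.
have ACherm : AC \is hermsymmx.
  by apply/is_hermitianmxP; rewrite expr0 scale1r -map_trmx /AC conj_toC map_trmx Asym.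
have /hermitian_normalmx /orthomx_spectralP := ACherm.
have /mxOverP dreal := hermitian_spectral_diag_real ACherm.
set P := spectralmx AC in dreal *; set D := spectral_diag AC in dreal * => ACE.
have Punit : P \in unitmx := spectral_unit AC.
have Pinv := invmx_unitary (spectral_unitarymx AC).
pose y := xC *m invmx P; pose z i := complex.Re `|y 0 i|.
have zE i : (z i ^+ 2)%:C%C = `|y 0 i| ^+ 2.
  by rewrite rmorphXn /= RRe_real // normr_real.
have dE i : (complex.Re (D 0 i))%:C%C = D 0 i by rewrite RRe_real.
have yJ : map_mx Num.conj y^T = P *m xC^T.
  rewrite /y Pinv trmx_mul map_mxM /= map_trmx trmxK -map_mx_comp.
  rewrite -[in X in _ *m X]map_trmx conj_toC; congr (_ *m _).
  by apply/matrixP => i j; rewrite !mxE /= conjCK.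
have PyJ : invmx P *m map_mx Num.conj y^T = xC^T by rewrite yJ mulKmx.
(* Forgetting the body of [y] stops [mxE] from unfolding its coordinates. *)
have yE : xC *m invmx P = y by [].
clearbody y.
exists (fun i => complex.Re (D 0 i)), (fun i => z i ^+ 2); split.
- move=> i; rewrite eigenvalue_root_char -(fmorph_root toC) /= dE map_char_poly.
  rewrite -eigenvalue_root_char; apply/eigenvalueP.
  exists (row i P); first rewrite -/AC ACE.
    rewrite !mulmxA -row_mul mulmxV // row1 -rowE row_diag_mx.
    by rewrite -scalemxAl -rowE.
  apply/eqP => /(congr1 (mulmxr (invmx P))) /=.
  rewrite -row_mul mulmxV // mul0mx => /rowP/(_ i).
  by rewrite !mxE eqxx => /eqP; rewrite oner_eq0.
- by move=> i; rewrite sqr_ge0.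
- apply: complexI; rewrite rmorph_sum /=.
  transitivity ((xC *m AC *m xC^T) 0 0).
    by rewrite /AC /xC map_trmx -!map_mxM [RHS]mxE.
  rewrite -PyJ ACE !mulmxA mulmxK // yE mul_mx_diag mxE; apply: eq_bigr => i _.
  by rewrite !mxE rmorphM /= dE zE normCK mulrAC mulrC.
- apply: complexI; rewrite rmorph_sum /=.
  transitivity ((xC *m xC^T) 0 0).
    by rewrite /xC map_trmx -!map_mxM [RHS]mxE.
  rewrite -PyJ mulmxA yE mxE; apply: eq_bigr => i _.
  by rewrite !mxE zE normCK.
Qed.

Lemma rayleigh_le_largest (R : realType) (k : nat) (A : 'M[R]_k)
    (x : 'rV[R]_k) : A^T = A ->
  (x *m A *m x^T) 0 0 <= largest_eigenvalue A * (x *m x^T) 0 0.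
Proof.
case/(symmetric_spectral_weights _ _ _ x) => d [w [dA w0 -> ->]].
rewrite mulr_sumr; apply: ler_sum => i _; apply: ler_wpM2r => //.
by case: (largest_eigenvalueP (dA i)) => _; apply.
Qed.

Lemma smallest_le_rayleigh (R : realType) (k : nat) (A : 'M[R]_k)
    (x : 'rV[R]_k) : A^T = A ->
  smallest_eigenvalue A * (x *m x^T) 0 0 <= (x *m A *m x^T) 0 0.
Proof.
case/(symmetric_spectral_weights _ _ _ x) => d [w [dA w0 -> ->]].
rewrite mulr_sumr; apply: ler_sum => i _; apply: ler_wpM2r => //.
by case: (smallest_eigenvalueP (dA i)) => _; apply.
Qed.

(** * Relative eigenvalues of binary quadratic forms *)

Lemma binary_form_ge0_disc (R : realFieldType) (a b c : R) :
  (forall s t, 0 <= a * s ^+ 2 + 2 * b * s * t + c * t ^+ 2) ->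
  [/\ 0 <= a, 0 <= c & b ^+ 2 <= a * c].
Proof.
move=> form_ge0.
have a0 : 0 <= a by have := form_ge0 1 0; lra.
have c0 : 0 <= c by have := form_ge0 0 1; lra.
split=> //; have [c_gt0 | c_le0] := ltP 0 c.
  (* The form at [(c, - b)] is [c] times the determinant. *)
  have := form_ge0 c (- b).
  have -> : a * c ^+ 2 + 2 * b * c * - b + c * (- b) ^+ 2
            = c * (a * c - b ^+ 2) by ring.
  by rewrite pmulr_rge0 // subr_ge0.
have cE : c = 0 by lra.
have [-> | b_neq0] := eqVneq b 0; first by rewrite cE mulr0 expr0n.
(* With [c = 0] the form is affine in [t]; this [t] makes it equal to -1. *)
have := form_ge0 1 (- (a + 1) / (2 * b)); rewrite cE.
have -> : a * 1 ^+ 2 + 2 * b * 1 * (- (a + 1) / (2 * b))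
          + 0 * (- (a + 1) / (2 * b)) ^+ 2 = -1 by field.
by rewrite oppr_ge0 ler10.
Qed.

(** The square root is the gap between the two eigenvalues of the form relative
    to [N s^2 + M t^2], and [a / N + c / M] is their sum: the conclusion says
    that [L] is at least the larger one. It holds because the difference of the
    two forms is positive semidefinite, so its trace is nonnegative and its
    determinant, which measures the difference of the squares of both sides,
    is nonnegative too. *)
Lemma binary_form_upper_bound (R : rcfType) (a b c N M L : R) :
  0 < N -> 0 < M ->
  (forall s t, a * s ^+ 2 + 2 * b * s * t + c * t ^+ 2
               <= L * (N * s ^+ 2 + M * t ^+ 2)) ->
  Num.sqrt ((a / N + c / M) ^+ 2 - 4 * (a * c - b ^+ 2) / (N * M))
    <= 2 * L - (a / N + c / M).
Proof.
move=> N0 M0 leL.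
have [|p0 q0 pq] := @binary_form_ge0_disc _ (L * N - a) (- b) (L * M - c).
  by move=> s t; have := leL s t; lra.
have [NE ME] : N != 0 /\ M != 0 by split; apply: lt0r_neq0.
have sumE : 2 * L - (a / N + c / M) = (L * N - a) / N + (L * M - c) / M.
  by field; rewrite NE ME.
have sum_ge0 : 0 <= 2 * L - (a / N + c / M).
  by rewrite sumE addr_ge0 ?divr_ge0 // ltW.
rewrite -[leRHS]ger0_norm // -sqrtr_sqr ler_wsqrtr // -subr_ge0.
have -> : (2 * L - (a / N + c / M)) ^+ 2
          - ((a / N + c / M) ^+ 2 - 4 * (a * c - b ^+ 2) / (N * M))
          = 4 * ((L * N - a) * (L * M - c) - (- b) ^+ 2) / (N * M).
  by field; rewrite NE ME.
by rewrite divr_ge0 ?(ltW (mulr_gt0 N0 M0)) // mulr_ge0 // subr_ge0.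
Qed.

(** Add the upper bound for the form to the one for its opposite, whose
    relative gap is the same and whose trace has the opposite sign: the traces
    cancel and both sides are twice those of the conclusion. *)
Lemma binary_form_gap (R : rcfType) (a b c N M L l : R) :
  0 < N -> 0 < M ->
  (forall s t, l * (N * s ^+ 2 + M * t ^+ 2)
               <= a * s ^+ 2 + 2 * b * s * t + c * t ^+ 2) ->
  (forall s t, a * s ^+ 2 + 2 * b * s * t + c * t ^+ 2
               <= L * (N * s ^+ 2 + M * t ^+ 2)) ->
  Num.sqrt ((a / N + c / M) ^+ 2 - 4 * (a * c - b ^+ 2) / (N * M)) <= L - l.
Proof.
move=> N0 M0 gel leL.
have upper := binary_form_upper_bound _ _ _ _ _ _ _ N0 M0 leL.
have leNl s t : - a * s ^+ 2 + 2 * - b * s * t + - c * t ^+ 2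
                <= - l * (N * s ^+ 2 + M * t ^+ 2).
  by have := gel s t; lra.
have lower := binary_form_upper_bound _ _ _ _ _ _ _ N0 M0 leNl.
have discE : (- a / N + - c / M) ^+ 2
             - 4 * (- a * - c - (- b) ^+ 2) / (N * M)
           = (a / N + c / M) ^+ 2 - 4 * (a * c - b ^+ 2) / (N * M).
  by ring.
rewrite discE in lower.
lra.
Qed.

(** * The adjacency matrix as a quadratic form on functions of the vertices *)

Lemma sum_enum_val (R : nmodType) (T : finType) (F : T -> R) :
  \sum_(i < #|T|) F (enum_val i) = \sum_x F x.
Proof. by rewrite -(big_enum_val F). Qed.

Lemma adjacency_mx_sym (R : realType) (G : sgraph) :
  (adjacency_mx R G)^T = adjacency_mx R G.
Proof. by apply/matrixP => i j; rewrite !mxE adj_sym. Qed.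

Lemma adjacency_form (R : realType) (G : sgraph) (f : G -> R)
    (x := \row_i f (enum_val i)) :
  (x *m adjacency_mx R G *m x^T) 0 0
  = \sum_u \sum_v f u * f v * (adj u v)%:R.
Proof.
rewrite exchange_big -sum_enum_val mxE /=.
apply: eq_bigr => j _.
rewrite !mxE mulr_suml -[RHS]sum_enum_val; apply: eq_bigr => i _.
by rewrite !mxE mulrAC.
Qed.

Lemma row_norm_sum (R : realType) (T : finType) (f : T -> R)
    (x := \row_(i < #|T|) f (enum_val i)) :
  (x *m x^T) 0 0 = \sum_u f u ^+ 2.
Proof.
by rewrite -sum_enum_val mxE; apply: eq_bigr => i _; rewrite !mxE expr2.
Qed.

(** * Counting adjacent pairs in the total graph *)

Lemma card_edge (G : sgraph) (a : edge G) : #|val a| = 2.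
Proof.
case: a => a /= /imsetP[[x y] /=]; rewrite inE /= => xy ->.
by rewrite cards2; case: eqP xy => // ->; rewrite adj_irr.
Qed.

(** The edges at [x] are the pairs [[set x; y]] with [y] a neighbour of [x],
    and [y] is determined by the pair because it differs from [x]. *)
Lemma sum_incident_edges (G : sgraph) (x : G) :
  (\sum_(a : edge G) (x \in val a))%N = degree x.
Proof.
rewrite -(big_sub (edges G) (fun a : {set G} => nat_of_bool (x \in a))).
rewrite -big_mkcondr sum1_card.
have inj : {in [set y | adj x y] &, injective (fun y => [set x; y])}.
  move=> y z; rewrite !inE => xy xz /setP/(_ y).
  rewrite !inE eqxx orbT => /esym/orP[/eqP yx | /eqP //].
  by rewrite yx adj_irr in xy.
rewrite /degree -(card_in_imset inj); apply: eq_card => a.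
rewrite [LHS]unfold_in /=; apply/andP/imsetP => [[] | [y]].
  case/imsetP => -[u v] /=; rewrite inE /= => uv ->.
  rewrite !inE => /orP[] /eqP ->; first by exists v; rewrite ?inE.
  by exists u; rewrite ?inE 1?adj_sym // setUC.
rewrite inE => xy ->; split; last by rewrite !inE eqxx.
by apply/imsetP; exists (x, y); rewrite ?inE.
Qed.

Lemma sum_incidence (G : sgraph) :
  (\sum_(x : G) \sum_(a : edge G) (x \in val a))%N = (2 * #|edges G|)%N.
Proof.
rewrite exchange_big /= mulnC -card_sig -sum_nat_const.
by apply: eq_bigr => a _; rewrite -big_mkcond sum1_card card_edge.
Qed.

Lemma sum_adj (G : sgraph) :
  (\sum_(x : G) \sum_(y : G) adj x y)%N = (2 * #|edges G|)%N.
Proof.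
rewrite -sum_incidence; apply: eq_bigr => x _.
rewrite sum_incident_edges -big_mkcond sum1_card /degree.
by apply: eq_card => y; rewrite !inE.
Qed.

(** Two distinct edges share at most one vertex, as both have two elements and
    the graph is simple. This turns line-graph adjacency into a quantity that
    can be summed over the vertices. *)
Lemma card_edgeI (G : sgraph) (a b : edge G) :
  #|val a :&: val b| = (line_adj a b + 2 * (a == b))%N.
Proof.
rewrite /line_adj; have [<- | ab] /= := eqVneq a b.
  by rewrite setIid card_edge.
rewrite addn0; case: existsP => [[x xab] | no_common] /=.
  apply/eqP; rewrite eqn_leq; apply/andP; split; last first.
    by apply/card_gt0P; exists x; rewrite inE.
  rewrite leqNgt; apply: contra ab => card_gt1; apply/eqP/val_inj.
  have aI : val a :&: val b = val a.
    by apply/eqP; rewrite eqEcard subsetIl card_edge.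
  have bI : val a :&: val b = val b.
    by apply/eqP; rewrite eqEcard subsetIr card_edge.
  by rewrite -bI aI.
apply/eqP; rewrite cards_eq0; apply/set0Pn => -[x]; rewrite inE => xab.
by apply: no_common; exists x.
Qed.

(** Count the triples of a vertex and two edges, possibly equal, containing it:
    there are [degree x ^ 2] at each vertex [x], and each pair of edges is
    counted as often as it has common vertices, the [2 m] coming from the
    pairs of equal edges. *)
Lemma sum_line_adj (G : sgraph) :
  (\sum_(a : edge G) \sum_(b : edge G) line_adj a b + 2 * #|edges G|)%N
  = zagreb G.
Proof.
transitivity (\sum_(a : edge G) \sum_(b : edge G) #|val a :&: val b|)%N.
  rewrite mulnC -card_sig -sum_nat_const -big_split /=.
  apply: eq_bigr => a _; under [RHS]eq_bigr do rewrite card_edgeI.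
  rewrite big_split /=; congr (_ + _)%N.
  by rewrite -big_distrr /= (bigD1 a) //= eqxx big1 ?addn0 // => b /negPf;
     rewrite eq_sym => ->.
have cardIE (a b : edge G) :
    #|val a :&: val b| = (\sum_(x : G) (x \in val a) * (x \in val b))%N.
  rewrite -sum1_card big_mkcond; apply: eq_bigr => x _.
  by rewrite inE mulnb; case: (_ && _).
under eq_bigr do under eq_bigr do rewrite cardIE.
under eq_bigr do rewrite exchange_big /=.
rewrite exchange_big; apply: eq_bigr => x _ /=.
rewrite expnS expn1 -[in RHS]sum_incident_edges big_distrl /=.
by apply: eq_bigr => a _; rewrite big_distrr.
Qed.

(** * The quadratic form of the total graph on blockwise constant vectors *)

Definition blockwise (R : realType) (G : sgraph) (s t : R) :
    total_graph G -> R :=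
  fun u => match u with inl _ => s | inr _ => t end.

Lemma blockwise_norm (R : realType) (G : sgraph) (s t : R) :
  \sum_u blockwise R G s t u ^+ 2
  = #|G|%:R * s ^+ 2 + #|edges G|%:R * t ^+ 2.
Proof.
by rewrite big_sumType /= !sumr_const !mulr_natl card_sig.
Qed.

Lemma blockwise_form (R : realType) (G : sgraph) (s t : R)
    (f := blockwise R G s t) :
  \sum_u \sum_v f u * f v * (@adj (total_graph G) u v)%:R
  = 2 * #|edges G|%:R * s ^+ 2 + 2 * (2 * #|edges G|%:R) * s * t
    + ((zagreb G)%:R - 2 * #|edges G|%:R) * t ^+ 2.
Proof.
have block (I J : finType) (p q : R) (r : I -> J -> bool) :
    \sum_i \sum_j p * q * (r i j)%:R
    = p * q * (\sum_i \sum_j r i j)%:R.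
  rewrite natr_sum mulr_sumr; apply: eq_bigr => i _.
  by rewrite natr_sum mulr_sumr.
rewrite big_sumType /=.
under eq_bigr do rewrite big_sumType /=.
under [X in _ + X]eq_bigr do rewrite big_sumType /=.
rewrite !big_split /= !block.
rewrite (exchange_big _ _ _ _ _ (fun (a : edge G) (x : G) => x \in val a : nat)).
rewrite sum_adj sum_incidence.
rewrite -sum_line_adj natrD !natrM.
ring.
Qed.

Theorem theorem25 (R : realType) (G : sgraph) (n m : nat)
    (hn : #|G| = n) (hm : #|edges G| = m) (hm1 : (1 <= m)%N)
    (hG : connected_graph G) :
  Num.sqrt
    (((2 * m%:R ^+ 2 + n%:R * ((zagreb G)%:R - 2 * m%:R)) / (m%:R * n%:R)) ^+ 2
     - 8 * ((zagreb G)%:R - 4 * m%:R) / n%:R)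
  <= spread R (total_graph G).
Proof.
have n_gt0 : (0 < n)%N.
  have /card_gt0P[a /imsetP[[x y] _ _]] : (0 < #|edges G|)%N by rewrite hm.
  by rewrite -hn; apply/card_gt0P; exists x.
have nR : 0 < n%:R :> R by rewrite ltr0n.
have mR : 0 < m%:R :> R by rewrite ltr0n.
pose T := total_graph G.
pose x s t : 'rV[R]_#|T| := \row_i blockwise R G s t (enum_val i).
have Tsym := adjacency_mx_sym R T.
have formE s t : (x s t *m adjacency_mx R T *m (x s t)^T) 0 0
    = 2 * m%:R * s ^+ 2 + 2 * (2 * m%:R) * s * t
      + ((zagreb G)%:R - 2 * m%:R) * t ^+ 2.
  by rewrite adjacency_form blockwise_form hm.
have normE s t : (x s t *m (x s t)^T) 0 0 = n%:R * s ^+ 2 + m%:R * t ^+ 2.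
  by rewrite row_norm_sum blockwise_norm hn hm.
have lower s t := smallest_le_rayleigh R _ _ (x s t) Tsym.
have upper s t := rayleigh_le_largest R _ _ (x s t) Tsym.
have gap := binary_form_gap R (2 * m%:R) (2 * m%:R) ((zagreb G)%:R - 2 * m%:R)
  _ _ (largest_eigenvalue (adjacency_mx R T))
  (smallest_eigenvalue (adjacency_mx R T)) nR mR.
apply: le_trans (gap _ _); last 2 first.
- by move=> s t; rewrite -formE -normE.
- by move=> s t; rewrite -formE -normE.
rewrite le_eqVlt; apply/orP; left; apply/eqP; congr Num.sqrt.
by field; rewrite !lt0r_neq0.
Qed.
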